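(* Let $\mathfrak{R}$ be a Bézout ring, let $I_1,\dots,I_M\in\mathbb{N}$ and $\mathbb{I}_M=\prod_{k=1}^M I_k$. Let $\mathcal{B}=[b_{\bm{i}_M,\bm{j}_M}]\in\mathfrak{R}^{I_1\times\cdots\times I_M\times I_1\times\cdots\times I_M}$ be a tensor, and let $(\psi_r,\psi_c)$ and $(\psi'_r,\psi'_c)$ be two unfolding maps with $\psi_r=\psi_c$ and $\psi'_r=\psi'_c$. Let $\bm{B},\bm{B}'\in\mathfrak{R}^{\mathbb{I}_M\times\mathbb{I}_M}$ be the unfolded matrices of $\mathcal{B}$ under $(\psi_r,\psi_c)$ and $(\psi'_r,\psi'_c)$ respectively, and let $\bm{P}\in\mathfrak{R}^{\mathbb{I}_M\times\mathbb{I}_M}$ be the permutation matrix from the index map given by $\psi_r$ to the index map given by $\psi'_r$. Then $\bm{B}'$ and $\bm{B}$ have the same eigenvalues, and whenever $\bm{v}$ is an eigenvector of $\bm{B}$ with $\bm{B}\bm{v}=\lambda\bm{v}$, the vector $\bm{P}^{-1}\bm{v}$ is an eigenvector of $\bm{B}'$ with the same eigenvalue $\lambda$.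
   Context: A Bézout ring is a commutative ring with identity in which every finitely generated ideal is principal. Write $[N]=\{1,\dots,N\}$, $\bm{i}_M=(i_1,\dots,i_M)$ and $\bm{j}_M=(j_1,\dots,j_M)$ for multi-indices in $[I_1]\times\cdots\times[I_M]$, and $\bm{I}_M=(I_1,\dots,I_M)$. An unfolding map is a pair $(\psi_r,\psi_c)$ of index mapping functions (row and column), each a bijection $\bm{i}_M\mapsto\psi(\bm{i}_M,\bm{I}_M)$ from $[I_1]\times\cdots\times[I_M]$ onto $[\mathbb{I}_M]$. The unfolded matrix of $\mathcal{B}$ under $(\psi_r,\psi_c)$ is the $\mathbb{I}_M\times\mathbb{I}_M$ matrix $\bm{B}$ whose entry in row $\psi_r(\bm{i}_M,\bm{I}_M)$ and column $\psi_c(\bm{j}_M,\bm{I}_M)$ is $b_{\bm{i}_M,\bm{j}_M}$, for all $\bm{i}_M,\bm{j}_M$. The permutation matrix $\bm{P}$ from the index map $\psi_r$ to the index map $\psi'_r$ is the $0/1$ matrix whose entry in position $(\psi_r(\bm{i}_M,\bm{I}_M),\psi'_r(\bm{i}_M,\bm{I}_M))$ is $1$ for every $\bm{i}_M$, and whose other entries are $0$. With this convention $\bm{B}'=\bm{P}^{-1}\bm{B}\bm{P}$. An eigenvalue of a square matrix $\bm{A}$ of size $n$ over $\mathfrak{R}$ is a scalar $\lambda\in\mathfrak{R}$ such that $\bm{A}\bm{v}=\lambda\bm{v}$ for some nonzero $\bm{v}\in\mathfrak{R}^n$; such $\bm{v}$ is an eigenvector. *)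

(* Defs.v *)
From HB Require Import structures.
From mathcomp Require Import all_boot all_order all_algebra.

Set Implicit Arguments.
Unset Strict Implicit.
Unset Printing Implicit Defensive.

Import GRing.Theory.
Local Open Scope ring_scope.

(* Written for [comPzRingType], so the zero ring is included. *)
Definition fg_ideal (R : comPzRingType) (n : nat) (a : 'I_n -> R) (x : R) : Prop :=
  exists c : 'I_n -> R, x = \sum_(i < n) c i * a i.

Definition principal_ideal (R : comPzRingType) (d : R) (x : R) : Prop :=
  exists c : R, x = c * d.

Definition bezout_ring (R : comPzRingType) : Prop :=
  forall (n : nat) (a : 'I_n -> R),
    exists d : R, forall x : R, fg_ideal a x <-> principal_ideal d x.

(* All indices are 0-based: [N] = {1, ..., N} is rendered as 'I_N. *)
Definition multi_index (M : nat) (I : 'I_M -> nat) : finType :=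
  {dffun forall k : 'I_M, 'I_(I k)}.

Definition total_dim (M : nat) (I : 'I_M -> nat) : nat :=
  (\prod_(k < M) I k)%N.

Definition index_mapping (M : nat) (I : 'I_M -> nat) : Type :=
  multi_index I -> 'I_(total_dim I).

Definition unfolding_map (M : nat) (I : 'I_M -> nat)
    (psir psic : index_mapping I) : Prop :=
  bijective psir /\ bijective psic.

Definition tensor (R : Type) (M : nat) (I : 'I_M -> nat) : Type :=
  multi_index I -> multi_index I -> R.

(* When (psir, psic) is an unfolding map, B exists and is unique: see
   [unfolded_mx_ex] and [unfolded_mx_uniq]. *)
Definition unfolded_mx (R : Type) (M : nat) (I : 'I_M -> nat)
    (psir psic : index_mapping I) (b : tensor R I) (B : 'M[R]_(total_dim I)) : Prop :=
  forall i j : multi_index I, B (psir i) (psic j) = b i j.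

Lemma unfolded_mx_ex (R : Type) (M : nat) (I : 'I_M -> nat)
    (psir psic : index_mapping I) (b : tensor R I) :
  unfolding_map psir psic -> exists B, unfolded_mx psir psic b B.
Proof.
move=> [[gr psirK _] [gc psicK _]].
exists (\matrix_(p, q) b (gr p) (gc q)) => i j.
by rewrite mxE psirK psicK.
Qed.

Lemma unfolded_mx_uniq (R : Type) (M : nat) (I : 'I_M -> nat)
    (psir psic : index_mapping I) (b : tensor R I) (B B' : 'M[R]_(total_dim I)) :
  unfolding_map psir psic ->
  unfolded_mx psir psic b B -> unfolded_mx psir psic b B' -> B = B'.
Proof.
move=> [[gr _ grK] [gc _ gcK]] hB hB'; apply/matrixP => p q.
by rewrite -(grK p) -(gcK q) hB hB'.
Qed.

Definition index_perm_mx (R : comPzRingType) (M : nat) (I : 'I_M -> nat)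
    (psi psi' : index_mapping I) : 'M[R]_(total_dim I) :=
  \matrix_(p, q)
    if [exists i : multi_index I, (psi i == p) && (psi' i == q)] then 1 else 0.

(* The library's [invmx] and [unitmx] need a [comUnitRingType]. *)
Definition inverse_mx (R : comPzRingType) (n : nat) (A C : 'M[R]_n) : Prop :=
  A *m C = 1%:M /\ C *m A = 1%:M.

(* The library's [eigenvalue] is about row vectors over a field. *)
Definition eigenvector_of (R : comPzRingType) (n : nat) (A : 'M[R]_n)
    (lambda : R) (v : 'cV[R]_n) : Prop :=
  v != 0 /\ A *m v = lambda *: v.

Definition eigenvalue_of (R : comPzRingType) (n : nat) (A : 'M[R]_n)
    (lambda : R) : Prop :=
  exists v : 'cV[R]_n, eigenvector_of A lambda v.

(* Main.v *)
Require Import Defs.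
From HB Require Import structures.
From mathcomp Require Import all_boot all_order all_algebra.

(** Both unfoldings use one index map for rows and for columns, so passing from
    the first to the second only renames the positions of a square matrix: the
    entry [b i j] moves from position [(psir i, psir j)] to
    [(psir' i, psir' j)].  The permutation matrix [P] performs this renaming:
    left multiplication by [P] makes row [psir i] of the result a copy of row
    [psir' i], and right multiplication makes column [psir' j] a copy of column
    [psir j] ([mul_index_perm_mxl], [mul_index_perm_mxr]).  Therefore [P] is invertible,
    its inverse being the matrix of the reverse change of index map
    ([index_perm_mx_inverse]), and [B P = P B'] ([unfolded_mx_conj]).

    Matrices related in this way by an invertible [P] are similar, and
    similarity transports eigenvectors ([eigenvector_of_similar]): [P^-1] takes
    those of [B] to those of [B'], and [P] takes them back, so that the
    eigenvalues agree. *)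

Set Implicit Arguments.
Unset Strict Implicit.
Unset Printing Implicit Defensive.

Import GRing.Theory.
Local Open Scope ring_scope.

Lemma inverse_mx_sym (R : comPzRingType) (n : nat) (Q C : 'M[R]_n) :
  inverse_mx Q C -> inverse_mx C Q.
Proof. by case. Qed.

Lemma intertwine_inverse (R : comPzRingType) (n : nat) (A A' Q C : 'M[R]_n) :
  inverse_mx Q C -> A *m Q = Q *m A' -> A' *m C = C *m A.
Proof.
move=> [QC CQ] AQ.
by rewrite -[A']mul1mx -CQ -(mulmxA C) -AQ -!mulmxA QC mulmx1.
Qed.

(** The vector [C *m v] cannot vanish, since [Q] recovers [v] from it. *)
Lemma eigenvector_of_similar (R : comPzRingType) (n : nat)
    (A A' Q C : 'M[R]_n) (lambda : R) (v : 'cV[R]_n) :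
  inverse_mx Q C -> A *m Q = Q *m A' ->
  eigenvector_of A lambda v -> eigenvector_of A' lambda (C *m v).
Proof.
move=> QC AQ [v0 Av]; split.
  apply: contra_neq v0 => Cv0.
  by rewrite -[v]mul1mx -QC.1 -mulmxA Cv0 mulmx0.
by rewrite mulmxA (intertwine_inverse QC AQ) -mulmxA Av scalemxAr.
Qed.

Section IndexPerm.

Variables (R : comPzRingType) (M : nat) (I : 'I_M -> nat).
Implicit Types (psi : index_mapping I) (i j : multi_index I).

Lemma eq_mx_index (psi psi' : index_mapping I) (A C : 'M[R]_(total_dim I)) :
  bijective psi -> bijective psi' ->
  (forall i j, A (psi i) (psi' j) = C (psi i) (psi' j)) -> A = C.
Proof.
move=> [g _ gK] [g' _ gK'] AC; apply/matrixP => p q.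
by rewrite -(gK p) -(gK' q).
Qed.

Lemma index_perm_mxE (psi psi' : index_mapping I) i j :
  injective psi -> injective psi' ->
  index_perm_mx R psi psi' (psi i) (psi' j) = (i == j)%:R.
Proof.
move=> inj inj'; rewrite mxE.
suff -> : [exists k, (psi k == psi i) && (psi' k == psi' j)] = (i == j).
  by case: (i == j).
apply/existsP/eqP => [[k /andP[/eqP/inj <- /eqP/inj' <-]] // | <-].
by exists i; rewrite !eqxx.
Qed.

Lemma mul_index_perm_mxl (psi psi' : index_mapping I) (n : nat)
    (A : 'M[R]_(total_dim I, n)) i q :
  injective psi -> bijective psi' ->
  (index_perm_mx R psi psi' *m A) (psi i) q = A (psi' i) q.
Proof.
move=> inj bij'; have inj' := bij_inj bij'.
rewrite mxE (reindex psi') /=; last exact: onW_bij.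
rewrite (bigD1 i) //= index_perm_mxE // eqxx mul1r big1 ?addr0 // => k ki.
by rewrite index_perm_mxE // eq_sym (negPf ki) mul0r.
Qed.

Lemma mul_index_perm_mxr (psi psi' : index_mapping I) (m : nat)
    (A : 'M[R]_(m, total_dim I)) p j :
  bijective psi -> injective psi' ->
  (A *m index_perm_mx R psi psi') p (psi' j) = A p (psi j).
Proof.
move=> bij inj'; have inj := bij_inj bij.
rewrite mxE (reindex psi) /=; last exact: onW_bij.
rewrite (bigD1 j) //= index_perm_mxE // eqxx mulr1 big1 ?addr0 // => k kj.
by rewrite index_perm_mxE // (negPf kj) mulr0.
Qed.

Lemma index_perm_mxK (psi psi' : index_mapping I) :
  bijective psi -> bijective psi' ->
  index_perm_mx R psi psi' *m index_perm_mx R psi' psi = 1%:M.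
Proof.
move=> bij bij'; have [inj inj'] := (bij_inj bij, bij_inj bij').
apply: (eq_mx_index bij bij) => i j.
by rewrite mul_index_perm_mxl // index_perm_mxE // mxE (inj_eq inj).
Qed.

Lemma index_perm_mx_inverse (psi psi' : index_mapping I) :
  bijective psi -> bijective psi' ->
  inverse_mx (index_perm_mx R psi psi') (index_perm_mx R psi' psi).
Proof. by move=> bij bij'; split; apply: index_perm_mxK. Qed.

(** Both products have the entry [b i j] at position [(psi i, psi' j)]: one
    copies columns of [B], the other copies rows of [B']. *)
Lemma unfolded_mx_conj (psi psi' : index_mapping I) (b : tensor R I)
    (B B' : 'M[R]_(total_dim I)) :
  bijective psi -> bijective psi' ->
  unfolded_mx psi psi b B -> unfolded_mx psi' psi' b B' ->
  B *m index_perm_mx R psi psi' = index_perm_mx R psi psi' *m B'.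
Proof.
move=> bij bij' hB hB'; have [inj inj'] := (bij_inj bij, bij_inj bij').
apply: (eq_mx_index bij bij') => i j.
by rewrite mul_index_perm_mxr // mul_index_perm_mxl // hB hB'.
Qed.

End IndexPerm.

Theorem theorem1 (R : comPzRingType) (hR : bezout_ring R)
    (M : nat) (I : 'I_M -> nat) (b : tensor R I)
    (psir psic psir' psic' : index_mapping I)
    (hpsi : unfolding_map psir psic) (hpsi' : unfolding_map psir' psic')
    (hrc : psir =1 psic) (hrc' : psir' =1 psic')
    (B B' P : 'M[R]_(total_dim I))
    (hB : unfolded_mx psir psic b B) (hB' : unfolded_mx psir' psic' b B')
    (hP : P = index_perm_mx R psir psir') :
  (forall lambda : R, eigenvalue_of B' lambda <-> eigenvalue_of B lambda) /\
  (exists2 Pinv : 'M[R]_(total_dim I), inverse_mx P Pinv &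
     forall (lambda : R) (v : 'cV[R]_(total_dim I)),
       eigenvector_of B lambda v -> eigenvector_of B' lambda (Pinv *m v)).
Proof.
have [[bij _] [bij' _]] := (hpsi, hpsi').
have {}hB : unfolded_mx psir psir b B by move=> i j; rewrite (hrc j) hB.
have {}hB' : unfolded_mx psir' psir' b B' by move=> i j; rewrite (hrc' j) hB'.
have PC : inverse_mx P (index_perm_mx R psir' psir).
  by rewrite hP; apply: index_perm_mx_inverse.
have BP : B *m P = P *m B' by rewrite hP (unfolded_mx_conj bij bij' hB hB').
split; last first.
  exists (index_perm_mx R psir' psir) => // lambda v.
  exact: eigenvector_of_similar BP.
move=> lambda; split=> -[v hv].
  exists (P *m v); apply: eigenvector_of_similar (inverse_mx_sym PC) _ hv.
  exact: intertwine_inverse PC BP.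
by exists (index_perm_mx R psir' psir *m v); apply: eigenvector_of_similar PC BP hv.
Qed.
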